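(* Let $\Delta$ be a finite dual polar space of rank $3$ whose quads are generalized quadrangles of order $(s,t)$, where $s\geq 2$ and $t\geq 2$. If $\Delta$ has an ovoid, then \[ s^2-s-t^2-t \geq 0 . \] In particular, for every prime power $q$ (even or odd), the symplectic dual polar space $DW(6,q)$ has no ovoid.
   Context: A finite dual polar space $\Delta$ of rank $3$ is the geometry dual to a finite (nondegenerate) polar space $\Pi$ of rank $3$: the points of $\Delta$ are the maximal singular subspaces (planes, projective dimension $2$) of $\Pi$, the lines of $\Delta$ are the lines (singular subspaces of projective dimension $1$) of $\Pi$, and the quads of $\Delta$ are the points of $\Pi$; incidence is (reversed) inclusion of singular subspaces. The points and lines of $\Delta$ incident with a given quad form a generalized quadrangle. That it has order $(s,t)$ means that each line has exactly $s+1$ points and each point of the quad is on exactly $t+1$ lines of the quad; the parameters $s,t$ are the same for all quads of $\Delta$. An ovoid of $\Delta$ is a set of points of $\Delta$ meeting every line of $\Delta$ in exactly one point. $DW(6,q)$ is the dual of the symplectic polar space $W(6,q)$ formed by the nonzero totally isotropic subspaces of a $6$-dimensional vector space over $\mathbb{F}_q$ with a nondegenerate alternating form: its points are the totally isotropic subspaces of vector dimension $3$, and its lines are the totally isotropic subspaces of vector dimension $2$, with incidence given by inclusion. Its quads have order $(q,q)$. *)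

(* Defs.v *)
From mathcomp Require Import all_boot all_order all_algebra.
From mathcomp Require Import sesquilinear.

Set Implicit Arguments.
Unset Strict Implicit.
Unset Printing Implicit Defensive.

Record geometry (T U : Type) := Geometry {
  points : {pred T};
  lines : {pred U};
  inc : T -> U -> bool
}.

Definition ovoid (T U : Type) (G : geometry T U) (O : {pred T}) : Prop :=
  {subset O <= points G} /\
  {in lines G, forall l, exists! x, (x \in O) && inc G x l}.

Definition generalized_quadrangle (T U : finType) (G : geometry T U)
    (s t : nat) : Prop :=
  [/\ (exists x, x \in points G) /\ (exists l, l \in lines G),
      {in lines G, forall l, #|[set x in points G | inc G x l]| = s.+1},
      {in points G, forall x, #|[set l in lines G | inc G x l]| = t.+1},
      {in points G &, forall x y, x != y ->
        {in lines G &, forall l m,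
          inc G x l -> inc G y l -> inc G x m -> inc G y m -> l = m}}
    & {in points G & lines G, forall x l, ~~ inc G x l ->
        exists! ym : T * U,
          [&& ym.1 \in points G, ym.2 \in lines G,
              inc G x ym.2, inc G ym.1 ym.2 & inc G ym.1 l]}].

Section PolarSpace.
Variables (P : finType) (L : {set {set P}}).

(* Reflexive even at a point that lies on no line. *)
Definition collinear (x y : P) : bool :=
  (x == y) || [exists l in L, (x \in l) && (y \in l)].

(* Nondegenerate polar spaces as axiomatized by Buekenhout and Shult, lines
   being sets of at least three points; that two lines share at most one point
   follows from the other axioms but is usually made part of the definition. *)
Definition polar_space : Prop :=
  [/\ {in L, forall l : {set P}, 3 <= #|l|},
      {in L &, forall l m : {set P}, l != m -> #|l :&: m| <= 1},
      forall x, {in L, forall l : {set P},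
        (exists! y, (y \in l) && collinear x y) \/
        {in l, forall y : P, collinear x y}}
    & forall x, exists y, ~~ collinear x y].

Definition subspace (A : {set P}) : bool :=
  [forall l in L, (1 < #|l :&: A|) ==> (l \subset A)].

Definition singular (A : {set P}) : bool :=
  subspace A && [forall x in A, forall y in A, collinear x y].

(* The rank is the number of nonempty members of a longest chain of singular
   subspaces, i.e. the vector (not projective) dimension of the largest ones. *)
Definition singular_chain (c : seq {set P}) : bool :=
  path (fun A B : {set P} => A \proper B) set0 c && all singular c.

Definition polar_rank (r : nat) : Prop :=
  (exists2 c, singular_chain c & size c = r) /\
  (forall c, singular_chain c -> size c <= r).

Definition dual_polar_space : geometry {set P} {set P} :=
  Geometry [set A | maxset singular A] L (fun A l => l \subset A).

Definition quad (x : P) : geometry {set P} {set P} :=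
  Geometry [set A in points dual_polar_space | x \in A]
           [set l in lines dual_polar_space | x \in l]
           (inc dual_polar_space).

End PolarSpace.

Section Symplectic.
Variables (F : fieldType) (V : vectType F) (f : {skew_symmetric V}%R).

(* Stronger than the skew-symmetry carried by f when F has characteristic 2. *)
Definition alternating : Prop := forall u, f u u = 0%R.

Definition totally_isotropic (U : {vspace V}) : bool := (U <= orthov f U)%VS.

(* DW(6,q) when V is 6-dimensional over the field with q elements and f is
   nondegenerate and alternating. *)
Definition symplectic_dual_polar_space : geometry {vspace V} {vspace V} :=
  Geometry [pred U : {vspace V} | totally_isotropic U && (\dim U == 3)]
           [pred U : {vspace V} | totally_isotropic U && (\dim U == 2)]
           (fun U l => (l <= U)%VS).

End Symplectic.

(* Main.v *)
Require Import Defs.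
From HB Require Import structures.
From mathcomp Require Import all_boot all_order all_algebra.
From mathcomp Require Import sesquilinear.
From mathcomp Require Import zify ring.

Set Implicit Arguments.
Unset Strict Implicit.
Unset Printing Implicit Defensive.
Import Order.TTheory GRing.Theory Num.Theory.

(** Call the maximal singular subspaces planes, and let [O] be an ovoid: a set
    of planes such that each line lies in exactly one member of [O].  Counting
    gives [1 + st] members of [O] through a point ([card_over]) and
    [(1 + st)(1 + st^2)] members in all ([card_ovoid]).

    Take a plane [x] outside [O].  Each of its [w = t^2 + t + 1] lines [l] lies
    in a unique member [z_l] of [O], and any two of the [z_l] share a point.  In
    the graph on [O] in which two planes are adjacent when they meet, the [z_l]
    thus form a clique of size [w].  This graph is the collinearity graph of a
    partial geometry whose lines, the points of the polar space, have [1 + st]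
    points each; its cliques have size at most [1 + st], by Hoffman's bound.
    Hence [t^2 + t <= st], that is [t < s], and this is the claim because
    [s^2 - s - t^2 - t = (s - t - 1)(s + t)].

    The proof below replaces the spectral bound by a variance.  For a plane
    [y] of [O] disjoint from [x] let [d_y] be the number of lines [l] of [x]
    such that [y] meets [z_l].  There are [t^3 (s^2 - s + 1)] such planes
    ([card_far]), the sum of the [d_y] is [w s t^3] ([sum_degree]) and the sum of
    their squares is [w t^3 (t^2 + t + s)] ([sum_degree_sqr]).  A sum of squared
    deviations from the mean is nonnegative, and it is a positive multiple of
    [s^2 - s - t^2 - t] ([ovoid_bound]).

    The counting uses only a few incidence properties, which [polar_planes]
    lists.  They hold in a polar space of rank 3 whose quads have order [(s, t)]
    ([polar_space_planes]), and in the symplectic space of dimension 6 over a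
    field with [q] elements ([symplectic_planes]), with [s = t = q], where the
    inequality reads [-2q >= 0]. *)

(** * Double counting *)

Lemma card_eq1_in (T : finType) (A : {set T}) a :
  a \in A -> (forall b, b \in A -> b = a) -> #|A| = 1.
Proof.
move=> aA Aa; apply/eqP/cards1P; exists a; apply/setP=> b; rewrite inE.
by apply/idP/eqP=> [/Aa|->].
Qed.

Lemma card_eq1_eq (T : finType) (A : {set T}) a b :
  #|A| = 1 -> a \in A -> b \in A -> a = b.
Proof. by move=> /eqP/cards1P[c ->]; rewrite !inE => /eqP-> /eqP->. Qed.

Lemma sum_incidence (T U : finType) (A : {set T}) (B : {set U}) (R : T -> U -> bool) :
  \sum_(a in A) #|[set b in B | R a b]| = \sum_(b in B) #|[set a in A | R a b]|.
Proof.
under eq_bigr => a _ do rewrite -sum1_card big_set big_mkcondr.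
rewrite exchange_big /=; apply: eq_bigr => b _.
by rewrite -sum1_card big_set [RHS]big_mkcondr.
Qed.

Lemma double_count (T U : finType) (A : {set T}) (B : {set U})
    (R : T -> U -> bool) i j :
    (forall a, a \in A -> #|[set b in B | R a b]| = i) ->
    (forall b, b \in B -> #|[set a in A | R a b]| = j) ->
  #|A| * i = #|B| * j.
Proof.
move=> Ai Bj; rewrite -!sum_nat_const -(eq_bigr _ Ai) -(eq_bigr _ Bj).
exact: sum_incidence.
Qed.

Lemma other_elt (T : finType) (A : {set T}) a :
  1 < #|A| -> exists2 b, b \in A & b != a.
Proof.
move=> A1; have /card_gt0P[b]: 0 < #|A :\ a|.
  by move: (cardsD1 a A); case: (a \in A); lia.
by rewrite !inE => /andP[ba bA]; exists b.
Qed.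

(** * Planes of a polar space *)

(** Two lines of the pencil at [p] each have a second point, and the line through
    these two points avoids [p]. *)
Lemma pencil_gt1_line_miss (P : finType) (L : {set {set P}}) (x : {set P}) (p : P) :
    {in L, forall l : {set P}, 1 < #|l|} ->
    (forall l m a b, l \in L -> m \in L -> a != b ->
      a \in l -> b \in l -> a \in m -> b \in m -> l = m) ->
    (forall a b, a \in x -> b \in x -> a != b ->
      exists2 l, l \in L & [/\ a \in l, b \in l & l \subset x]) ->
    1 < #|[set l in L | (p \in l) && (l \subset x)]| ->
  exists2 l, l \in L & l \subset x /\ p \notin l.
Proof.
move=> l_gt1 l_uniq x_line c1.
have [l] := other_elt set0 c1; rewrite inE => /and3P[lL pl lx] _.
have [m] := other_elt l c1; rewrite inE => /and3P[mL pm mx] ml.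
have [a al ap] := other_elt p (l_gt1 _ lL).
have [b bm bp] := other_elt p (l_gt1 _ mL).
have ab : a != b.
  by apply: contra_neq ml => ab; apply: (l_uniq _ _ b p) => //; rewrite -ab.
have [k kL [ak bk kx]] := x_line _ _ (subsetP lx _ al) (subsetP mx _ bm) ab.
exists k => //; split=> //; apply: contra_neqN ml => pk.
by rewrite (l_uniq m k b p) // (l_uniq l k a p).
Qed.

(** This interface lets one counting argument serve axiomatic polar spaces and
    vector spaces alike.  Of the parameters of the quads it fixes [t] by the
    pencils of a plane; that lines have [t + 1] points follows ([line_card]). *)
Record polar_planes (P : finType) (L Pi : {set {set P}}) (s t : nat) : Prop :=
  PolarPlanes {
  line_gt1 : forall l, l \in L -> 1 < #|l|;
  line_uniq : forall l m a b, l \in L -> m \in L -> a != b ->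
    a \in l -> b \in l -> a \in m -> b \in m -> l = m;
  plane_line : forall x a b, x \in Pi -> a \in x -> b \in x -> a != b ->
    exists2 l, l \in L & [/\ a \in l, b \in l & l \subset x];
  plane_meet : forall x l m, x \in Pi -> l \in L -> m \in L ->
    l \subset x -> m \subset x -> exists2 a, a \in l & a \in m;
  plane_perp : forall x p, x \in Pi -> p \notin x ->
    exists2 h, h \in L & h \subset x /\
      {in x, forall r, (r \in h) = collinear L p r};
  line_span : forall l p, l \in L -> p \notin l ->
    {in l, forall r, collinear L p r} ->
    exists2 x, x \in Pi & l \subset x /\ p \in x;
  pencil : forall x p, x \in Pi -> p \in x ->
    #|[set l in L | (p \in l) && (l \subset x)]| = t.+1;
  line_planes : forall l, l \in L -> #|[set x in Pi | l \subset x]| = s.+1;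
  some_line : exists l, l \in L
}.

Section Planes.
Variables (P : finType) (L Pi : {set {set P}}) (s t : nat).
Hypothesis G : polar_planes L Pi s t.
Hypotheses (s_gt0 : 0 < s) (t_gt0 : 0 < t).
Implicit Types (p r a b : P) (l m h x y : {set P}).

Local Notation "p _|_ r" := (collinear L p r) (at level 70).

Lemma collinear_line l p r : l \in L -> p \in l -> r \in l -> p _|_ r.
Proof.
by move=> lL pl rl; apply/orP; right; apply/existsP; exists l; rewrite lL pl rl.
Qed.

Lemma collinear_neq p r : p _|_ r -> p != r ->
  exists2 l, l \in L & p \in l /\ r \in l.
Proof.
case/orP=> [->//|/existsP[l /and3P[lL pl rl]] _]; by exists l.
Qed.

Lemma collinear_sym p r : (p _|_ r) = (r _|_ p).
Proof.
rewrite /collinear eq_sym; congr (_ || _).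
by apply: eq_existsb => l; rewrite [(p \in l) && _]andbC.
Qed.

Lemma collinear_plane x p r : x \in Pi -> p \in x -> r \in x -> p _|_ r.
Proof.
move=> xP px rx; case: (eqVneq p r) => [->|pr]; first by rewrite /collinear eqxx.
by have [l lL [pl rl _]] := plane_line G xP px rx pr; apply: collinear_line lL pl rl.
Qed.

Lemma line_subset x l a b : x \in Pi -> l \in L -> a != b ->
  a \in l -> b \in l -> a \in x -> b \in x -> l \subset x.
Proof.
move=> xP lL ab al bl ax bx.
have [m mL [am bm mx]] := plane_line G xP ax bx ab.
by rewrite (line_uniq G lL mL ab).
Qed.

Lemma line_two l p : l \in L -> exists2 a, a \in l & a != p.
Proof. by move=> lL; apply: other_elt (line_gt1 G lL). Qed.

Lemma line_has l : l \in L -> exists p, p \in l.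
Proof. by move=> /(line_gt1 G) lt1; apply/card_gt0P; lia. Qed.

Lemma line_eqS l m : l \in L -> m \in L -> l \subset m -> l = m.
Proof.
move=> lL mL /subsetP lm; have [a al] := line_has lL.
have [b bl ba] := line_two a lL.
by apply: (line_uniq G lL mL ba) => //; apply: lm.
Qed.

Lemma line_miss x p : x \in Pi -> p \in x ->
  exists2 l, l \in L & l \subset x /\ p \notin l.
Proof.
move=> xP px; apply: (pencil_gt1_line_miss (line_gt1 G) (line_uniq G)).
  by move=> a b; apply: (plane_line G xP).
by rewrite (pencil G).
Qed.

(** A point off [x] is collinear only with the points of a line of [x], by
    [plane_perp]; a point collinear with more than a line is therefore in [x]. *)
Lemma perp_mem x p l : x \in Pi -> l \in L -> l \subset x ->
  (forall r, r \in l -> p _|_ r) -> forall r, r \in x -> r \notin l -> p _|_ r ->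
  p \in x.
Proof.
move=> xP lL lx pl r rx rl pr; apply/negPn/negP => px.
have [h hL [hx hP]] := plane_perp G xP px.
have lh : l = h.
  by apply: line_eqS => //; apply/subsetP=> q ql; rewrite hP ?pl // (subsetP lx).
by rewrite lh hP ?pr in rl.
Qed.

(** Every point of [y] is collinear with [p] and with all of [l], so it is in
    [x] by [perp_mem], and conversely. *)
Lemma plane_uniq x y l p : x \in Pi -> y \in Pi -> l \in L ->
  l \subset x -> l \subset y -> p \notin l -> p \in x -> p \in y -> x = y.
Proof.
move=> xP yP lL lx ly pl px py; apply/eqP; rewrite eqEsubset.
apply/andP; split; apply/subsetP=> a ax.
  apply: (@perp_mem _ _ l) py _ _ => // [r rl|].
    by apply: collinear_plane ax _ => //; apply: (subsetP lx).
  exact: collinear_plane ax px.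
apply: (@perp_mem _ _ l) px _ _ => // [r rl|].
  by apply: collinear_plane ax _ => //; apply: (subsetP ly).
exact: collinear_plane ax py.
Qed.

Lemma plane_of_two x y l m : x \in Pi -> y \in Pi -> l \in L -> m \in L ->
  l != m -> l \subset x -> l \subset y -> m \subset x -> m \subset y -> x = y.
Proof.
move=> xP yP lL mL lm lx ly mx my.
have /subsetPn[p pm pl] : ~~ (m \subset l).
  by apply: contra_neqN lm => /(line_eqS mL lL).
by apply: (plane_uniq xP yP lL lx ly pl); [apply: (subsetP mx)|apply: (subsetP my)].
Qed.

Lemma point_off x l : x \in Pi -> l \in L -> l \subset x ->
  exists2 p, p \in x & p \notin l.
Proof.
move=> xP lL lx; have [q ql] := line_has lL.
have [m mL [mx qm]] := line_miss xP (subsetP lx _ ql).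
have /subsetPn[p pm pl] : ~~ (m \subset l).
  by apply: contraNN qm => /(line_eqS mL lL)->.
by exists p => //; apply: (subsetP mx).
Qed.

(** Projection from [p] matches the points of [l] with the lines of [x] on
    [p]. *)
Lemma pencil_miss x l p : x \in Pi -> l \in L -> l \subset x -> p \in x ->
  p \notin l -> #|l| = t.+1.
Proof.
move=> xP lL lx px pl; rewrite -(pencil G xP px).
rewrite -[LHS]muln1 -[RHS]muln1.
apply: (@double_count _ _ _ _ (fun (a : P) (m : {set P}) => a \in m)) => [a al|m].
  have ap : a != p by apply: contraNneq pl => <-.
  have [m mL [am pm mx]] := plane_line G xP (subsetP lx _ al) px ap.
  apply: (@card_eq1_in _ _ m); rewrite ?inE ?mL ?pm ?mx // => k.
  by rewrite !inE -!andbA => /and4P[kL pk kx ak]; apply: (line_uniq G kL mL ap).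
rewrite inE => /and3P[mL pm mx].
have [a am al] := plane_meet G xP mL lL mx lx.
apply: (@card_eq1_in _ _ a); rewrite ?inE ?al // => b.
rewrite !inE => /andP[bl bm]; apply: contraNeq pl => ba.
by rewrite (line_uniq G lL mL ba).
Qed.

Lemma line_plane l : l \in L -> exists2 x, x \in Pi & l \subset x.
Proof.
move=> lL; have /card_gt0P[x] : 0 < #|[set x in Pi | l \subset x]|.
  by rewrite (line_planes G).
by rewrite inE => /andP[]; exists x.
Qed.

Lemma line_card l : l \in L -> #|l| = t.+1.
Proof.
move=> lL; have [x xP lx] := line_plane lL.
by have [p px pl] := point_off xP lL lx; apply: pencil_miss px pl.
Qed.

Lemma card_lineD1 l p : l \in L -> p \in l -> #|l :\ p| = t.
Proof. by move=> /line_card; rewrite (cardsD1 p) => + pl; rewrite pl => -[]. Qed.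

Lemma plane_has x : x \in Pi -> exists p, p \in x.
Proof.
move=> xP; have [l lL] := some_line G; have [p pl] := line_has lL.
case: (boolP (p \in x)) => [|/(plane_perp G xP)[h hL [hx _]]]; first by exists p.
by have [a ah] := line_has hL; exists a; apply: (subsetP hx).
Qed.

Lemma plane_card x : x \in Pi -> #|x| = t ^ 2 + t + 1.
Proof.
move=> xP; have [p px] := plane_has xP.
suff : #|x :\ p| * 1 = #|[set l in L | (p \in l) && (l \subset x)]| * t.
  by rewrite (pencil G) // (cardsD1 p x) px; lia.
apply: (@double_count _ _ _ _ (fun (a : P) (m : {set P}) => a \in m)).
  move=> a; rewrite !inE => /andP[ap ax].
  have [l lL [al pl lx]] := plane_line G xP ax px ap.
  apply: (@card_eq1_in _ _ l) => [|m]; first by rewrite !inE lL pl lx.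
  by rewrite !inE -!andbA => /and4P[mL pm mx am]; apply: (line_uniq G mL lL ap).
move=> l; rewrite inE => /and3P[lL pl lx]; rewrite -(card_lineD1 lL pl).
congr #|pred_of_set _|; apply/setP=> a; rewrite !inE -andbA; congr (_ && _).
by case: (boolP (a \in l)) => [/(subsetP lx)->|]; rewrite ?andbF.
Qed.

Definition plane_lines x := [set l in L | l \subset x].

Lemma card_plane_lines x : x \in Pi -> #|plane_lines x| = t ^ 2 + t + 1.
Proof.
move=> xP; apply/eqP; rewrite -(eqn_pmul2r (ltn0Sn t)) -(plane_card xP); apply/eqP.
apply: (@double_count _ _ _ _ (fun l (a : P) => a \in l)) => [l|a ax].
  rewrite inE => /andP[lL lx]; rewrite -(line_card lL).
  congr #|pred_of_set _|; apply/setP=> a; rewrite !inE.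
  by case: (boolP (a \in l)) => [/(subsetP lx)->|]; rewrite ?andbF.
rewrite -(pencil G xP ax).
by congr #|pred_of_set _|; apply/setP=> l; rewrite !inE -andbA [(_ \in l) && _]andbC.
Qed.

Lemma card_lines_off x p : x \in Pi -> p \in x ->
  #|[set l in plane_lines x | p \notin l]| = t ^ 2.
Proof.
move=> xP px; have := card_plane_lines xP.
rewrite -(cardsID [set l : {set P} | p \in l] (plane_lines x)).
have -> : plane_lines x :&: [set l : {set P} | p \in l] =
    [set l in L | (p \in l) && (l \subset x)].
  by apply/setP=> l; rewrite !inE -andbA [(_ \in l) && _]andbC.
rewrite (pencil G) //.
have -> : plane_lines x :\: [set l : {set P} | p \in l] =
    [set l in plane_lines x | p \notin l].
  by apply/setP=> l; rewrite !inE andbC.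
have -> : t ^ 2 + t + 1 = t.+1 + t ^ 2 by lia.
by move/addnI.
Qed.

Lemma card_points_off x l : x \in Pi -> l \in L -> l \subset x ->
  #|x :\: l| = t ^ 2.
Proof.
move=> xP lL lx; rewrite cardsD (setIidPr lx) (plane_card xP) (line_card lL); lia.
Qed.

(** * Ovoids: global counts *)

Variable O : {set {set P}}.
Hypothesis OPi : {subset O <= Pi}.
Hypothesis O1 : forall l, l \in L -> #|[set y in O | l \subset y]| = 1.

Definition over p (A : {set {set P}}) := [set y in A | p \in y].

Lemma ovoid_ex l : l \in L -> exists2 y, y \in O & l \subset y.
Proof.
move=> lL; have /card_gt0P[y] : 0 < #|[set y in O | l \subset y]| by rewrite O1.
by rewrite inE => /andP[]; exists y.
Qed.

Lemma ovoid_uniq l x y : l \in L -> x \in O -> y \in O ->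
  l \subset x -> l \subset y -> x = y.
Proof.
by move=> lL xO yO lx ly; apply: (card_eq1_eq (O1 lL)); rewrite inE ?xO ?yO.
Qed.

(** Two common points would span a common line, and a line lies in one member of
    [O] only. *)
Lemma ovoid_meet x y a b : x \in O -> y \in O -> a != b ->
  a \in x -> b \in x -> a \in y -> b \in y -> x = y.
Proof.
move=> xO yO ab ax bx ay by_.
have [l lL [al bl lx]] := plane_line G (OPi xO) ax bx ab.
exact: (ovoid_uniq lL xO yO lx (line_subset (OPi yO) lL ab al bl ay by_)).
Qed.

(** This is the size of an ovoid of a generalized quadrangle of order [(s, t)].
    Let [o] be the member of [O] on [l].  The [s] other planes on [l] contain [t]
    further lines on [p] each.  The member of [O] on such a line is not [o],
    and each [y] in [O] on [p] other than [o] arises exactly once, from the line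
    of points of [y] collinear with a point [a] of [l] other than [p]. *)
Lemma card_over p l : l \in L -> p \in l -> #|over p O| = 1 + s * t.
Proof.
move=> lL pl; have [o oO lo] := ovoid_ex lL.
pose W := [set w in Pi | l \subset w] :\ o.
pose M := [set m in L | [&& p \in m, m != l & [exists w in W, m \subset w]]].
have cW : #|W| = s.
  have := line_planes G lL; rewrite (cardsD1 o) inE (OPi oO) lo /=.
  by rewrite add1n => -[].
have WP w : w \in W -> [/\ w \in Pi, l \subset w & w != o].
  by rewrite !inE => /and3P[].
have cM : #|W| * t = #|M| * 1.
  apply: (@double_count _ _ _ _ (fun w m : {set P} => m \subset w)) => [w wW|m].
    have [wP lw _] := WP _ wW.
    have := pencil G wP (subsetP lw _ pl).
    rewrite (cardsD1 l [set m in L | _]) inE lL pl lw /=.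
    rewrite add1n => -[<-]; congr #|pred_of_set _|; apply/setP=> m; rewrite !inE.
    case: (boolP (m \subset w)) => mw; rewrite ?andbF ?andbT //.
    rewrite [in RHS]andbC -andbA; congr (_ && (_ && _)).
    suff -> : [exists w in W, m \subset w] by rewrite andbT.
    by apply/existsP; exists w; rewrite wW.
  rewrite inE => /and4P[mL pm ml /existsP[w /andP[wW mw]]].
  apply: (@card_eq1_in _ _ w); first by rewrite inE wW.
  move=> w'; rewrite inE => /andP[w'W mw'].
  have [[wP lw _] [w'P lw' _]] := (WP _ wW, WP _ w'W).
  exact: plane_of_two w'P wP mL lL ml mw' mw lw' lw.
have cO : #|M| * 1 = #|over p O :\ o| * 1.
  apply: (@double_count _ _ _ _ (fun (m y : {set P}) => m \subset y)) => [m|y].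
    rewrite inE => /and4P[mL pm ml /existsP[w /andP[wW mw]]].
    have [wP lw wo] := WP _ wW; have [y yO my] := ovoid_ex mL.
    apply: (@card_eq1_in _ _ y) => [|y'].
      rewrite !inE yO my (subsetP my _ pm) !andbT.
      apply: contra_neq wo => yo; rewrite yo in my.
      exact: plane_of_two wP (OPi oO) mL lL ml mw my lw lo.
    rewrite !inE => /andP[/and3P[_ y'O _] my'].
    exact: ovoid_uniq mL y'O yO my' my.
  rewrite !inE => /and3P[yo yO py].
  have [a al ap] := line_two p lL.
  have ay : a \notin y.
    apply: contra_neqN yo => ay.
    by apply: (@ovoid_meet _ _ a p) => //; apply: (subsetP lo).
  have [m mL [my mE]] := plane_perp G (OPi yO) ay.
  have pm : p \in m by rewrite mE // (collinear_line lL).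
  have am : a \notin m by apply: contraNN ay => /(subsetP my).
  have ml : m != l by apply: contraNneq am => ->.
  have [r|w wP [mw aw]] := line_span G mL am.
    by move=> rm; rewrite -mE // (subsetP my).
  have lw : l \subset w.
    by apply: (line_subset wP lL ap) => //; apply: (subsetP mw).
  apply: (@card_eq1_in _ _ m).
    rewrite !inE mL pm ml my andbT; apply/existsP; exists w.
    rewrite !inE wP lw mw !andbT; apply: contra_neq yo => wo.
    by rewrite wo in mw; apply: ovoid_uniq mL yO oO my mw.
  move=> k; rewrite !inE => /andP[/and4P[kL pk kl /existsP[v /andP[vW kv]]] ky].
  have [vP lv _] := WP _ vW.
  apply: line_eqS => //; apply/subsetP => r rk; rewrite mE ?(subsetP ky) //.
  by apply: collinear_plane vP _ _; [apply: (subsetP lv) | apply: (subsetP kv)].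
rewrite (cardsD1 o) !inE oO (subsetP lo _ pl) /=.
by move: cM cO; rewrite cW !muln1 => -> ->.
Qed.

Lemma card_lines_at p (A : {set {set P}}) j : {subset A <= Pi} ->
    {in L, forall l, #|[set y in A | l \subset y]| = j} ->
  #|[set l in L | p \in l]| * j = #|over p A| * t.+1.
Proof.
move=> API Aj.
apply: (@double_count _ _ _ _ (fun (l y : {set P}) => l \subset y)) => [l|y].
  rewrite inE => /andP[lL pl]; rewrite -(Aj l lL).
  congr #|pred_of_set _|; apply/setP=> y; rewrite !inE -andbA.
  by case: (boolP (l \subset y)) => [/subsetP->|]; rewrite ?andbF.
rewrite inE => /andP[yA py]; rewrite -(pencil G (API _ yA) py).
by congr #|pred_of_set _|; apply/setP=> l; rewrite !inE andbA.
Qed.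

(** Counting pairs of a line on [p] and a plane on that line: each of the lines
    on [p] is in one member of [O] and in [s + 1] planes, so there are [s + 1]
    times as many planes on [p] as members of [O] on [p]. *)
Lemma card_planes_over p l : l \in L -> p \in l ->
  #|over p Pi| = (1 + s) * (1 + s * t).
Proof.
move=> lL pl; have cO := card_lines_at p OPi O1.
have cP := card_lines_at p (fun y (yP : y \in Pi) => yP) (line_planes G).
move: cO cP; rewrite (card_over lL pl) muln1 => -> E.
apply/eqP; rewrite -(eqn_pmul2r (ltn0Sn t)) -E; apply/eqP; ring.
Qed.

(** Fix a point [p].  A member [y] of [O] off [p] is determined by the line [m]
    of points of [y] collinear with [p], being the member of [O] on [m].  The lines
    [m] that occur are the lines off [p] in the planes on [p] outside [O]: if the
    plane spanned by [p] and [m] were in [O], it would be [y], which misses [p]. *)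
Lemma card_ovoid : #|O| = (1 + s * t) * (1 + s * t ^ 2).
Proof.
have [l lL] := some_line G; have [p pl] := line_has lL.
pose A := [set x in over p Pi | x \notin O].
pose M := [set m in L | (p \notin m) && [exists x in A, m \subset x]].
have AP x : x \in A -> [/\ x \in Pi, p \in x & x \notin O].
  by rewrite !inE -andbA => /and3P[].
have cM : #|A| * t ^ 2 = #|M| * 1.
  apply: (@double_count _ _ _ _ (fun (x m : {set P}) => m \subset x)) => [x xA|m].
    have [xP px _] := AP _ xA; rewrite -(card_lines_off xP px).
    congr #|pred_of_set _|; apply/setP=> m; rewrite !inE.
    case: (boolP (m \subset x)) => mx; rewrite ?andbF //= !andbT.
    suff -> : [exists x in A, m \subset x] by rewrite andbT.
    by apply/existsP; exists x; rewrite xA.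
  rewrite inE => /and3P[mL pm /existsP[x /andP[xA mx]]].
  apply: (@card_eq1_in _ _ x) => [|y]; first by rewrite inE xA.
  rewrite inE => /andP[yA my].
  have [[xP px _] [yP py _]] := (AP _ xA, AP _ yA).
  exact: plane_uniq yP xP mL my mx pm py px.
have cO : #|M| * 1 = #|O :\: over p O| * 1.
  apply: (@double_count _ _ _ _ (fun (m y : {set P}) => m \subset y)) => [m|y].
    rewrite inE => /and3P[mL pm /existsP[x /andP[xA mx]]].
    have [xP px xO] := AP _ xA; have [y yO my] := ovoid_ex mL.
    apply: (@card_eq1_in _ _ y) => [|z].
      rewrite !inE yO my !andbT; apply: contraNN xO => py.
      by rewrite (plane_uniq xP (OPi yO) mL mx my pm).
    rewrite !inE -andbA => /and3P[_ zO mz]; exact: ovoid_uniq mL zO yO mz my.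
  rewrite !inE => /andP[+ yO]; rewrite yO /= => py; have yP := OPi yO.
  have [m mL [my mE]] := plane_perp G yP py.
  have pm : p \notin m by apply: contraNN py => /(subsetP my).
  have [r|x xP [mx px]] := line_span G mL pm.
    by move=> rm; rewrite -mE // (subsetP my).
  apply: (@card_eq1_in _ _ m).
    rewrite !inE mL pm my andbT; apply/existsP; exists x.
    rewrite !inE xP px mx andbT; apply: contraNN py => xO.
    by rewrite (ovoid_uniq mL yO xO my mx).
  move=> k; rewrite !inE => /andP[/and3P[kL pk /existsP[v /andP[vA kv]]] ky].
  have [vP pv _] := AP _ vA.
  apply: line_eqS => //; apply/subsetP => r rk; rewrite mE ?(subsetP ky) //.
  by apply: collinear_plane vP pv _; apply: (subsetP kv).
have sO : over p O \subset O by apply/subsetP=> y; rewrite inE => /andP[].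
have cA : #|over p Pi| = #|over p O| + #|A|.
  rewrite -(cardsID O); congr (_ + _); congr #|pred_of_set _|; apply/setP=> x.
    rewrite !inE; case: (boolP (x \in O)) => [/OPi->|]; rewrite ?andbF //=.
    by rewrite andbT.
  by rewrite !inE andbC.
move: cM cO; rewrite cardsD (setIidPr sO) !muln1 => <- E.
have := subset_leq_card sO.
move: cA; rewrite (card_planes_over lL pl) (card_over lL pl) in E *.
move: E; set n := #|O|; set a := #|A| => E E' lo.
have -> : n = 1 + s * t + a * t ^ 2 by rewrite E; lia.
have -> : a = s * (1 + s * t) by move: E'; rewrite mulnDl mul1n => /addnI.
by ring.
Qed.

(** * The variance argument *)

Section OffPlane.
Variable x : {set P}.
Hypotheses (xP : x \in Pi) (xO : x \notin O).

Definition far := [set y in O | [disjoint y & x]].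

(** A plane [y] of [O] meets [x] in nothing, in a point or in a line, and in each
    case [1 + t * (number of common lines) = [y and x disjoint] + (number of
    common points)].  Summing over [O] gives the claim, since each line of [x] is
    in one member of [O] and each point of [x] is in [1 + st] members. *)
Lemma card_far : #|far| + (t ^ 2 + t + 1) * (1 + s * t) = #|O| + (t ^ 2 + t + 1) * t.
Proof.
have Ly : \sum_(y in O) #|[set l in plane_lines x | l \subset y]| = t ^ 2 + t + 1.
  rewrite -(card_plane_lines xP) -sum1_card.
  rewrite (sum_incidence _ _ (fun y l : {set P} => l \subset y)).
  by apply: eq_bigr => l; rewrite inE => /andP[lL _]; rewrite O1.
have Py : \sum_(y in O) #|[set p in x | p \in y]| = (t ^ 2 + t + 1) * (1 + s * t).
  rewrite -(plane_card xP) -sum_nat_const.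
  rewrite (sum_incidence _ _ (fun (y : {set P}) p => p \in y)).
  apply: eq_bigr => p px; have [l lL pl] : exists2 l, l \in L & p \in l.
    have /card_gt0P[l] : 0 < #|[set l in L | (p \in l) && (l \subset x)]|.
      by rewrite (pencil G).
    by rewrite inE => /and3P[]; exists l.
  exact: card_over lL pl.
have Dy : #|far| = \sum_(y in O) [disjoint y & x].
  by rewrite -sum1_card /far big_set big_mkcondr.
rewrite -Py -[in RHS]Ly Dy -sum1_card big_distrl /= -!big_split /=.
apply: eq_bigr => y yO; have yP := OPi yO.
have yx : y != x by apply: contraNneq xO => <-.
case: (boolP [disjoint y & x]) => [yx0|/pred0Pn[p /= /andP[py px]]].
  rewrite (_ : [set p in x | p \in y] = set0); last first.
    apply/setP=> p; rewrite !inE andbC; apply/negbTE; rewrite negb_and.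
    by case: (boolP (p \in y)) => // /(disjointFr yx0)->.
  rewrite (_ : [set l in plane_lines x | l \subset y] = set0) ?cards0 //.
  apply/setP=> l; rewrite !inE; apply/negbTE/negP => /andP[/andP[lL lx] ly].
  have [p pl] := line_has lL.
  by have := disjointFr yx0 (subsetP ly _ pl); rewrite (subsetP lx).
case: (boolP [exists b in x, (b \in y) && (b != p)]); last first.
  move=> /existsPn none; have pE b : b \in x -> b \in y -> b = p.
    by move=> bx by_; apply/eqP; move: (none b); rewrite bx by_ negbK.
  rewrite (@card_eq1_in _ [set q in x | q \in y] p); first last.
  - by move=> q; rewrite inE => /andP[/pE].
  - by rewrite inE px.
  rewrite (_ : [set l in plane_lines x | l \subset y] = set0) ?cards0 //.
  apply/setP=> l; rewrite !inE; apply/negbTE/negP => /andP[/andP[lL lx] ly].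
  have [a al ap] := line_two p lL.
  by move: ap; rewrite (pE a) ?eqxx ?(subsetP lx) ?(subsetP ly).
case/existsP=> b /and3P[bx by_ bp].
have [l lL [bl pl lx]] := plane_line G xP bx px bp.
have ly := line_subset yP lL bp bl pl by_ py.
rewrite (@card_eq1_in _ [set k in plane_lines x | k \subset y] l); first last.
- move=> k; rewrite !inE => /andP[/andP[kL kx] ky]; apply/eqP.
  apply: contraNT xO => kl.
  by rewrite (plane_of_two xP yP kL lL kl kx ky lx ly).
- by rewrite !inE lL lx.
rewrite (_ : [set q in x | q \in y] = l) ?(line_card lL) ?mul1n //.
apply/setP=> q; rewrite inE; apply/andP/idP => [[qx qy]|ql].
  apply: contraNT xO => qnl.
  by rewrite (plane_uniq xP yP lL lx ly qnl qx qy).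
by rewrite (subsetP lx) // (subsetP ly).
Qed.

Lemma off_line_notin l z p : l \in L -> l \subset x -> z \in O -> l \subset z ->
  p \in z :\: l -> p \notin x.
Proof.
move=> lL lx zO lz; rewrite inE => /andP[pl pz]; apply: contraNN xO => px.
by rewrite (plane_uniq xP (OPi zO) lL lx lz pl px pz).
Qed.

(** If [y] had a point [r] in [x], then [p] would be collinear with [r] and with
    all of [l], hence in [x]. *)
Lemma far_of_point l z p y : l \in L -> l \subset x -> z \in O -> l \subset z ->
  p \in z :\: l -> y \in O -> p \in y -> y != z -> y \in far.
Proof.
move=> lL lx zO lz pzl yO py yz; rewrite inE yO /=.
have px := off_line_notin lL lx zO lz pzl; move: pzl; rewrite inE => /andP[pl pz].
apply/pred0Pn => -[r /= /andP[ry rx]].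
have rz : r \notin z.
  apply: contra_neqN yz => rz; apply: (@ovoid_meet _ _ p r) => //.
  by apply: contraNneq px => ->.
have rl : r \notin l by apply: contraNN rz => /(subsetP lz).
case/negP: px; apply: (perp_mem xP lL lx _ rx rl).
  move=> q ql; apply: collinear_plane (OPi zO) pz _; exact: (subsetP lz).
exact: collinear_plane (OPi yO) py ry.
Qed.

Lemma far_meet l z y : l \in L -> l \subset x -> z \in O -> l \subset z ->
  y \in far -> ~~ [disjoint y & z] ->
  #|[set p in z :\: l | p \in y]| = 1.
Proof.
move=> lL lx zO lz; rewrite inE => /andP[yO yx] /pred0Pn[p /= /andP[py pz]].
have zl q : q \in l -> q \notin y.
  by move=> /(subsetP lx) qx; rewrite (disjointFl yx).
apply: (@card_eq1_in _ _ p) => [|q].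
  rewrite !inE pz py !andbT; by apply: contraTN py; apply: zl.
rewrite !inE -andbA => /and3P[ql qz qy]; apply/eqP; apply: contraT => qp.
have yz := ovoid_meet yO zO qp qy py qz pz.
have [a al] := line_has lL.
by have := zl _ al; rewrite yz (subsetP lz).
Qed.

(** By [far_of_point] these planes are the members of [O] on the points of [z]
    off [l], apart from [z] itself; there are [t^2] such points, with [s t]
    planes on each. *)
Lemma card_far_meet l z : l \in L -> l \subset x -> z \in O -> l \subset z ->
  #|[set y in far | ~~ [disjoint y & z]]| = s * t ^ 3.
Proof.
move=> lL lx zO lz; have zP := OPi zO.
rewrite (_ : s * t ^ 3 = t ^ 2 * (s * t)); last by ring.
rewrite -(card_points_off zP lL lz) -[LHS]muln1; apply/esym.
apply: (@double_count _ _ _ _ (fun p (y : {set P}) => p \in y)) => [p pzl|y].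
  have [pl pz] : p \notin l /\ p \in z by move: pzl; rewrite inE => /andP[].
  have [a al] := line_has lL.
  have ap : a != p by apply: contraNneq pl => <-.
  have [k kL [_ pk _]] := plane_line G zP (subsetP lz _ al) pz ap.
  have := card_over kL pk; rewrite (cardsD1 z) !inE zO pz /= => /addnI <-.
  congr #|pred_of_set _|; apply/setP=> y; rewrite !inE.
  case: (boolP (y \in O)) => yO; last by rewrite !andbF.
  case: (boolP (p \in y)) => py; last by rewrite !andbF.
  rewrite !andbT /=; case: (eqVneq y z) => [->|yz].
    apply/negbTE; rewrite negb_and; apply/orP; left.
    by apply/pred0Pn; exists a; rewrite /= (subsetP lz) // (subsetP lx).
  have := far_of_point lL lx zO lz pzl yO py yz; rewrite inE yO /= => ->.
  by apply/pred0Pn; exists p; rewrite /= py.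
by rewrite inE => /andP[yF yz]; apply: (far_meet lL lx zO lz yF yz).
Qed.

(** For [p] in [z] off [l], the planes in question on [p] correspond to the points
    [r] of [w] collinear with [p].  These form a line [h] through the common
    point [c] of [l] and [m], and [c] itself is excluded since [y] is disjoint
    from [x].  So there are [t] planes for each of the [t^2] points [p]. *)
Lemma card_far_meet2 l m z w : l \in L -> m \in L -> l != m ->
  l \subset x -> m \subset x -> z \in O -> w \in O -> l \subset z -> m \subset w ->
  #|[set y in far | ~~ [disjoint y & z] && ~~ [disjoint y & w]]| = t ^ 3.
Proof.
move=> lL mL lm lx mx zO wO lz mw; have [zP wP] := (OPi zO, OPi wO).
have [c cl cm] := plane_meet G xP lL mL lx mx.
have cx := subsetP lx _ cl.
have cw := subsetP mw _ cm; have cz := subsetP lz _ cl.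
have wz : w != z.
  apply: contraNneq xO => wz; rewrite wz in mw.
  by rewrite (plane_of_two xP zP lL mL lm lx lz mx mw).
rewrite (_ : t ^ 3 = t ^ 2 * t); last by ring.
rewrite -(card_points_off zP lL lz) -[LHS]muln1; apply/esym.
apply: (@double_count _ _ _ _ (fun p (y : {set P}) => p \in y)) => [p pzl|y]; last first.
  by rewrite inE => /and3P[yF yz _]; apply: (far_meet lL lx zO lz yF yz).
have px := off_line_notin lL lx zO lz pzl.
have [pl pz] : p \notin l /\ p \in z by move: pzl; rewrite inE => /andP[].
have pc : p != c by apply: contraNneq px => ->.
have pw : p \notin w.
  by apply: contra_neqN wz => pw; apply: (ovoid_meet wO zO pc).
have [h hL [hw hE]] := plane_perp G wP pw.
have ch : c \in h by rewrite hE // (collinear_plane zP).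
rewrite -(card_lineD1 hL ch) -[LHS]muln1 -[RHS]muln1.
apply: (@double_count _ _ _ _ (fun (y : {set P}) r => r \in y)) => [y|r].
  rewrite inE => /andP[+ py]; rewrite inE => /and3P[yF yz /pred0Pn[r /= /andP[ry rw]]].
  move: yF; rewrite inE => /andP[yO yx].
  apply: (@card_eq1_in _ _ r) => [|q].
    rewrite !inE ry hE // (collinear_plane (OPi yO) py ry) !andbT.
    by apply: contraTneq ry => ->; rewrite (disjointFl yx).
  rewrite !inE -andbA => /and3P[_ qh qy]; apply/eqP; apply: contraNT pw => qr.
  by rewrite -(ovoid_meet yO wO qr qy ry (subsetP hw _ qh) rw).
rewrite !inE => /andP[rc rh]; have rw := subsetP hw _ rh.
have rz : r \notin z.
  by apply: contra_neqN wz => rz; apply: (ovoid_meet wO zO rc).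
have pr : p != r by apply: contraNneq pw => ->.
have [k kL [pk rk]] : exists2 k, k \in L & p \in k /\ r \in k.
  by apply: collinear_neq pr; rewrite -hE.
have [y yO ky] := ovoid_ex kL.
have [py ry] := (subsetP ky _ pk, subsetP ky _ rk).
apply: (@card_eq1_in _ _ y) => [|v].
  rewrite inE ry andbT inE py andbT inE.
  have yz : y != z by apply: contraNneq rz => <-.
  rewrite (far_of_point lL lx zO lz pzl yO py yz) /=.
  apply/andP; split; apply/pred0Pn; [exists p|exists r].
    by rewrite /= py.
  by rewrite /= ry.
rewrite inE => /andP[+ rv]; rewrite inE => /andP[+ pv]; rewrite inE => /andP[+ _].
rewrite inE => /andP[vO _]; exact: ovoid_meet pr _ _ _ _.
Qed.

(** The default [set0] never occurs for a line [l]. *)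
Definition ovoid_at l : {set P} := odflt set0 [pick y in O | l \subset y].

Lemma ovoid_atP l : l \in L -> ovoid_at l \in O /\ l \subset ovoid_at l.
Proof.
rewrite /ovoid_at => /ovoid_ex[y yO ly]; case: pickP => [z /andP[]//|/(_ y)].
by rewrite yO ly.
Qed.

Definition degree y := #|[set l in plane_lines x | ~~ [disjoint y & ovoid_at l]]|.

Lemma sum_degree : \sum_(y in far) degree y = (t ^ 2 + t + 1) * (s * t ^ 3).
Proof.
rewrite /degree (sum_incidence _ _ (fun y l => ~~ [disjoint y & ovoid_at l])).
rewrite -(card_plane_lines xP) -sum_nat_const; apply: eq_bigr => l.
by rewrite inE => /andP[lL lx]; have [] := ovoid_atP lL; apply: card_far_meet.
Qed.

(** The square [degree y ^ 2] counts the ordered pairs of lines of [x] whose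
    ovoid planes meet [y]; the equal pairs are counted by [card_far_meet], the
    others by [card_far_meet2]. *)
Lemma sum_degree_sqr : \sum_(y in far) degree y ^ 2 =
  (t ^ 2 + t + 1) * (s * t ^ 3 + (t ^ 2 + t) * t ^ 3).
Proof.
pose R (y l : {set P}) := ~~ [disjoint y & ovoid_at l].
have dE y : degree y ^ 2 =
    #|[set k in setX (plane_lines x) (plane_lines x) | R y k.1 && R y k.2]|.
  rewrite expnS expn1 -cardsX; congr #|pred_of_set _|; apply/setP => -[l m].
  by rewrite !inE /= -!andbA; do !bool_congr.
rewrite (eq_bigr _ (fun y _ => dE y)).
rewrite (sum_incidence _ _ (fun y k => R y k.1 && R y k.2)).
rewrite (eq_bigl (fun k => (k.1 \in plane_lines x) && (k.2 \in plane_lines x))).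
  2: by move=> [l m]; rewrite in_setX.
rewrite -(pair_big (mem (plane_lines x)) (mem (plane_lines x))
  (fun l m => #|[set y in far | R y l && R y m]|)) /=.
rewrite -(card_plane_lines xP) -sum_nat_const; apply: eq_bigr => l lx'.
move: (lx'); rewrite inE => /andP[lL lx]; have [zO lz] := ovoid_atP lL.
rewrite (bigD1 l) //= ; congr (_ + _).
  rewrite -(card_far_meet lL lx zO lz); congr #|pred_of_set _|.
  by apply/setP=> y; rewrite !inE andbb.
have <- : #|plane_lines x :\ l| = t ^ 2 + t.
  by have := card_plane_lines xP; rewrite (cardsD1 l) lx' add1n addn1 => -[].
rewrite -sum_nat_const; apply: eq_big => [m|m /andP[]]; first by rewrite !inE andbC.
rewrite inE => /andP[mL mx] ml; have [wO mw] := ovoid_atP mL.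
by apply: (card_far_meet2 lL mL); rewrite // eq_sym.
Qed.

End OffPlane.

Lemma some_plane_off : exists2 x, x \in Pi & x \notin O.
Proof.
have [l lL] := some_line G; have [o oO lo] := ovoid_ex lL.
have c1 : 1 < #|[set x in Pi | l \subset x]| by rewrite (line_planes G).
have [x] := other_elt o c1; rewrite inE => /andP[xP lx] xo; exists x => //.
by apply: contra_neqN xo => xO; apply: (ovoid_uniq lL).
Qed.

(** The mean of [degree] over the planes disjoint from [x] is [s * w / a], with
    [a] and [w] as in the proof, so the sum of squares that starts the proof is
    [a ^ 2] times the sum of squared deviations from the mean. *)
Lemma ovoid_bound : 1 < s ->
  (0 <= s%:Z ^+ 2 - s%:Z - t%:Z ^+ 2 - t%:Z :> int)%R.
Proof.
move=> s1; have [x xP xO] := some_plane_off.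
have cF := card_far xP xO; rewrite card_ovoid in cF.
have S1 := sum_degree xP xO; have S2 := sum_degree_sqr xP xO.
pose a : int := (s%:Z ^+ 2 - s%:Z + 1)%R.
pose w : int := (t%:Z ^+ 2 + t%:Z + 1)%R.
have pos : (0 <= \sum_(y in far x) (a * (degree x y)%:Z - s%:Z * w) ^+ 2)%R.
  by apply: sumr_ge0 => y _; apply: sqr_ge0.
have sumE : (\sum_(y in far x) (a * (degree x y)%:Z - s%:Z * w) ^+ 2 =
   a ^+ 2 * (\sum_(y in far x) degree x y ^ 2)%N%:Z
   - 2 * a * s%:Z * w * (\sum_(y in far x) degree x y)%N%:Z
   + (s%:Z * w) ^+ 2 * #|far x|%:Z)%R.
  rewrite -sum1_card !(big_morph _ PoszD (erefl (Posz 0))) !big_distrr /=.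
  rewrite -sumrN -!big_split /=; apply: eq_bigr => y _.
  by rewrite expnS expn1 PoszM; ring.
have farE : (#|far x|%:Z = t%:Z ^+ 3 * a)%R.
  by move: cF; rewrite /a; move: #|far x| => N; lia.
have a_gt0 : (0 < a)%R.
  have s1' : (0 < s%:Z - 1)%R by rewrite subr_gt0.
  rewrite (_ : a = s%:Z * (s%:Z - 1) + 1)%R; last by rewrite /a; ring.
  by rewrite ltr_wpDl // mulr_ge0 // ltW.
have w_gt0 : (0 < w)%R by rewrite ltr_wpDl // addr_ge0 // sqr_ge0.
have t_pos : (0 < t%:Z ^+ 3 :> int)%R by apply: exprn_gt0.
have c_gt0 : (0 < t%:Z ^+ 3 * a * w * (s%:Z - 1))%R.
  by rewrite !mulr_gt0 // subr_gt0.
have : (0 <= t%:Z ^+ 3 * a * w * (s%:Z - 1) *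
   (s%:Z ^+ 2 - s%:Z - t%:Z ^+ 2 - t%:Z))%R.
  move: pos; rewrite sumE S1 S2 farE; set E := (X in (0 <= X)%R).
  suff -> : E = (t%:Z ^+ 3 * a * w * (s%:Z - 1) *
    (s%:Z ^+ 2 - s%:Z - t%:Z ^+ 2 - t%:Z))%R by [].
  rewrite /E ?expnS ?expn0 ?(PoszM, PoszD) /a /w; ring.
by rewrite pmulr_rge0.
Qed.

End Planes.

(** * Polar spaces of rank 3 *)

Section PolarSpacePlanes.
Variables (P : finType) (L : {set {set P}}) (s t : nat).
Hypotheses (polarL : polar_space L) (rank3 : polar_rank L 3).
Hypothesis quadsL : forall x : P, generalized_quadrangle (quad L x) s t.
Hypotheses (s_gt0 : 0 < s) (t_gt0 : 0 < t).
Implicit Types (p r a b : P) (l m h x y A C : {set P}).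

Local Notation "p _|_ r" := (collinear L p r) (at level 70).
Let Pi := [set A | maxset (singular L) A].

Definition clique A := [forall a in A, forall b in A, a _|_ b].

Lemma cliqueP A : reflect {in A &, forall a b, a _|_ b} (clique A).
Proof.
apply: (iffP forall_inP) => [cA a b aA bA|cA a aA].
  exact: (forall_inP (cA a aA)).
by apply/forall_inP => b; apply: cA.
Qed.

Lemma polar_line_gt1 l : l \in L -> 1 < #|l|.
Proof. by case: polarL => + _ _ _ lL; move/(_ l lL)/ltnW. Qed.

Lemma polar_line_uniq l m a b : l \in L -> m \in L -> a != b ->
  a \in l -> b \in l -> a \in m -> b \in m -> l = m.
Proof.
case: polarL => _ lm1 _ _ lL mL ab al bl am bm; apply/eqP; apply: contraT => lm.
have := lm1 _ _ lL mL lm; rewrite leqNgt => /negP[]; apply/card_gt1P.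
by exists a, b; rewrite !inE al am bl bm.
Qed.

Lemma two_collinear l p a b : l \in L -> a \in l -> b \in l -> a != b ->
  p _|_ a -> p _|_ b -> {in l, forall r, p _|_ r}.
Proof.
case: polarL => _ _ oa _ lL al bl ab pa pb; case: (oa p l lL) => // -[c [_ cu]].
by move: ab; rewrite -(cu a) ?al // -(cu b) ?bl // eqxx.
Qed.

Lemma one_collinear l p : l \in L -> exists2 a, a \in l & p _|_ a.
Proof.
case: polarL => _ _ oa _ lL; case: (oa p l lL) => [[c [/andP[cl pc] _]]|pl].
  by exists c.
have /card_gt0P[a al] := ltnW (polar_line_gt1 lL).
by exists a => //; apply: pl.
Qed.

Lemma singular_clique A : singular L A -> clique A.
Proof. by case/andP. Qed.

Lemma singular_line A a b : singular L A -> a \in A -> b \in A -> a != b ->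
  exists2 l, l \in L & [/\ a \in l, b \in l & l \subset A].
Proof.
case/andP=> /forall_inP sA cA aA bA ab.
have [l lL [al bl]] := collinear_neq (cliqueP _ cA a b aA bA) ab.
exists l => //; split=> //; apply: (implyP (sA l lL)).
by apply/card_gt1P; exists a, b; rewrite !inE aA bA al bl.
Qed.

(** The points collinear with all of [A] form a subspace, and for a maximal clique
    [A] they are the points of [A].  So maximal cliques are maximal singular
    subspaces, and a clique lies in a plane without any recourse to spans. *)
Lemma max_clique_subspace A : maxset clique A -> subspace L A.
Proof.
case/maxsetP=> /cliqueP cA maxA; apply/forall_inP => l lL; apply/implyP.
case/card_gt1P => a [b []]; rewrite !inE => /andP[al aA] /andP[bl bA] ab.
apply/subsetP => c cl.
have cp d : d \in A -> d _|_ c.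
  by move=> dA; apply: (two_collinear lL al bl ab) => //; apply: cA.
rewrite -(maxA (c |: A)) ?setU11 ?subsetUr //; apply/cliqueP => d e.
rewrite !inE => /predU1P[->|dA] /predU1P[->|eA].
- by rewrite /collinear eqxx.
- by rewrite collinear_sym cp.
- exact: cp.
- exact: cA.
Qed.

Lemma clique_plane C : clique C -> exists2 x, x \in Pi & C \subset x.
Proof.
move=> cC; have [x mx Cx] := maxset_exists cC; exists x => //.
rewrite inE; apply/maxsetP; split=> [|B /singular_clique cB].
  by rewrite /singular max_clique_subspace //; case/maxsetP: mx.
by case/maxsetP: mx => _; apply.
Qed.

Lemma planeS x : x \in Pi -> singular L x.
Proof. by rewrite inE => /maxsetP[]. Qed.

Lemma plane_sup x A : x \in Pi -> clique A -> x \subset A -> A = x.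
Proof.
move=> xP cA xA; have [y yP Ay] := clique_plane cA.
have : y = x.
  move: xP; rewrite inE => /maxsetP[_]; apply; first exact: planeS.
  exact: subset_trans xA Ay.
by move=> yx; apply/eqP; rewrite eqEsubset xA -yx Ay.
Qed.

Lemma plane_perp_mem x p : x \in Pi -> {in x, forall r, p _|_ r} -> p \in x.
Proof.
move=> xP px; rewrite -(plane_sup xP (A := p |: x)) ?setU11 ?subsetUr //.
have /cliqueP cx := singular_clique (planeS xP); apply/cliqueP => d e.
rewrite !inE => /predU1P[->|dA] /predU1P[->|eA].
- by rewrite /collinear eqxx.
- exact: px.
- by rewrite collinear_sym px.
- exact: cx.
Qed.

Lemma singular1 p : singular L [set p].
Proof.
apply/andP; split; last first.
  by apply/cliqueP => a b /set1P-> /set1P->; rewrite /collinear eqxx.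
apply/forall_inP => l _; apply/implyP => /card_gt1P[a [b []]].
by rewrite !inE => /andP[_ /eqP->] /andP[_ /eqP->]; rewrite eqxx.
Qed.

Lemma singular_of_line l : l \in L -> singular L l.
Proof.
move=> lL; apply/andP; split.
  apply/forall_inP => m mL; apply/implyP => /card_gt1P[a [b []]].
  rewrite !inE => /andP[am al] /andP[bm bl] ab.
  by rewrite (polar_line_uniq mL lL ab).
by apply/cliqueP => a b; apply: collinear_line.
Qed.

(** Otherwise a point of [l], [l], [A] and [x] would form a chain of four
    singular subspaces, more than the rank allows. *)
Lemma between_line_plane x A l : x \in Pi -> l \in L -> singular L A ->
  l \subset A -> A \proper x -> A = l.
Proof.
move=> xP lL sA lA Ax; apply/eqP; rewrite eq_sym eqEproper lA /=; apply/negP => lA'.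
have /card_gt1P[a [b [al bl ab]]] := polar_line_gt1 lL.
case: rank3 => _ /(_ [:: [set a]; l; A; x]) chain; suff : 4 <= 3 by [].
apply: chain.
rewrite /singular_chain /= lA' Ax singular1 singular_of_line // sA planeS // !andbT.
apply/andP; split; apply/properP; split.
- by rewrite sub0set.
- by exists a; rewrite !inE.
- by rewrite sub1set.
- by exists b; rewrite // inE eq_sym.
Qed.

Lemma quad_pencil x p : x \in Pi -> p \in x ->
  #|[set l in L | (p \in l) && (l \subset x)]| = t.+1.
Proof.
move=> xP px; case: (quadsL p) => _ _ + _ _ => /(_ x); rewrite !inE px andbT.
rewrite inE in xP; rewrite xP => <- //.
by congr #|pred_of_set _|; apply/setP => l; rewrite !inE -andbA.
Qed.

Lemma quad_line_planes l : l \in L -> #|[set x in Pi | l \subset x]| = s.+1.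
Proof.
move=> lL; have /card_gt0P[p pl] := ltnW (polar_line_gt1 lL).
case: (quadsL p) => _ + _ _ _ => /(_ l); rewrite !inE lL pl => <- //.
congr #|pred_of_set _|; apply/setP => x; rewrite !inE -andbA.
by rewrite /=; case: (boolP (l \subset x)) => [/subsetP->|]; rewrite ?andbF.
Qed.

Lemma polar_line_miss x p : x \in Pi -> p \in x ->
  exists2 l, l \in L & l \subset x /\ p \notin l.
Proof.
move=> xP px; apply: (pencil_gt1_line_miss polar_line_gt1 polar_line_uniq).
  by move=> a b; apply: singular_line; apply: planeS.
by rewrite quad_pencil.
Qed.

Definition trace x p := [set r in x | p _|_ r].

Lemma trace_singular x p : x \in Pi -> singular L (trace x p).
Proof.
move=> xP; have /andP[/forall_inP sx /cliqueP cx] := planeS xP; apply/andP; split.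
  apply/forall_inP => l lL; apply/implyP => /card_gt1P[a [b []]].
  rewrite !inE => /and3P[al ax pa] /and3P[bl bx pb] ab.
  have lx : l \subset x.
    apply: (implyP (sx l lL)); apply/card_gt1P.
    by exists a, b; rewrite !inE al ax bl bx.
  apply/subsetP => r rl; rewrite inE (subsetP lx) //=.
  exact: (two_collinear lL al bl ab).
by apply/cliqueP => a b; rewrite !inE => /andP[ax _] /andP[bx _]; apply: cx.
Qed.

Lemma trace_proper x p : x \in Pi -> p \notin x -> trace x p \proper x.
Proof.
move=> xP px; rewrite properE; apply/andP; split.
  by apply/subsetP => a; rewrite inE => /andP[].
apply: contraNN px => /subsetP xt; apply: plane_perp_mem => // r /xt.
by rewrite inE => /andP[].
Qed.

(** The trace meets every line of [x], and for each of its points some line of [x]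
    misses that point; so it has two points, hence contains a line, and it is
    that line by the bound on the rank. *)
Lemma trace_line x p : x \in Pi -> p \notin x -> trace x p \in L.
Proof.
move=> xP px; have sT := trace_singular p xP.
have T_of l : l \in L -> l \subset trace x p -> trace x p \in L.
  by move=> lL lT; rewrite (between_line_plane xP lL sT lT) // trace_proper.
have meet l : l \in L -> l \subset x -> exists2 a, a \in l & a \in trace x p.
  move=> lL lx; have [a al pa] := one_collinear p lL.
  by exists a; rewrite // inE pa (subsetP lx).
have [q qx] : exists q, q \in x.
  apply/set0Pn; apply: contraTneq xP => x0; apply/negP => xP.
  have := plane_sup xP (singular_clique (singular1 p)); rewrite x0 sub0set.
  by move=> /(_ isT) /setP/(_ p); rewrite !inE eqxx.
have [k kL [kx _]] := polar_line_miss xP qx.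
have [a ak aT] := meet k kL kx.
have ax : a \in x by move: aT; rewrite inE => /andP[].
have [m mL [mx am]] := polar_line_miss xP ax.
have [b bm bT] := meet m mL mx.
have ab : a != b by apply: contraNneq am => ->.
by have [l lL [_ _ lT]] := singular_line sT aT bT ab; apply: T_of lT.
Qed.

Lemma polar_space_planes : polar_planes L Pi s t.
Proof.
split.
- exact: polar_line_gt1.
- exact: polar_line_uniq.
- by move=> x a b xP; apply: singular_line; apply: planeS.
- move=> x l m xP lL mL lx mx.
  (* [l] is the trace on [x] of a point [a] of another plane on [l], and a
     trace meets every line of [x]. *)
  have c1 : 1 < #|[set y in Pi | l \subset y]| by rewrite quad_line_planes.
  have [y] := other_elt x c1; rewrite inE => /andP[yP ly] yx.
  have /subsetPn[a ay ax] : ~~ (y \subset x).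
    apply: contra_neqN yx => yx; apply/esym; apply: (plane_sup yP) yx.
    exact: singular_clique (planeS xP).
  have lT : l \subset trace x a.
    apply/subsetP => r rl; rewrite inE (subsetP lx) //=.
    apply: (cliqueP _ (singular_clique (planeS yP))) => //; exact: (subsetP ly).
  have <- := between_line_plane xP lL (trace_singular a xP) lT (trace_proper xP ax).
  have [b bm ab] := one_collinear a mL.
  by exists b; rewrite // inE ab (subsetP mx).
- move=> x p xP px; exists (trace x p); first exact: trace_line.
  split; first by apply/subsetP => a; rewrite inE => /andP[].
  by move=> r rx; rewrite inE rx.
- move=> l p lL pl perp; have [] := @clique_plane (p |: l).
    have /cliqueP cl := singular_clique (singular_of_line lL).
    apply/cliqueP => d e; rewrite !inE => /predU1P[->|dA] /predU1P[->|eA].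
    + by rewrite /collinear eqxx.
    + exact: perp.
    + by rewrite collinear_sym perp.
    + exact: cl.
  by move=> x xP; rewrite subUset sub1set => /andP[]; exists x.
- exact: quad_pencil.
- exact: quad_line_planes.
have [[[|A c] //= + _] _] := rank3.
case/andP=> /andP[/properP[_ [p pA _]] _] _.
have [_ [l]] : (exists x, x \in points (quad L p)) /\
    (exists l, l \in lines (quad L p)) by case: (quadsL p).
by rewrite inE => /andP[lL _]; exists l.
Qed.

End PolarSpacePlanes.

Lemma polar_space_ovoid_bound (P : finType) (L : {set {set P}}) (s t : nat) :
  polar_space L -> polar_rank L 3 ->
  (forall x : P, generalized_quadrangle (quad L x) s t) ->
  2 <= s -> 0 < t ->
  (exists O : {pred {set P}}, ovoid (dual_polar_space L) O) ->
  (0 <= s%:Z ^+ 2 - s%:Z - t%:Z ^+ 2 - t%:Z :> int)%R.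
Proof.
move=> pL r3 qL s2 t0 [O [OP O1]].
have G := polar_space_planes pL r3 qL (ltnW s2) t0.
apply: (@ovoid_bound _ _ _ _ _ G (ltnW s2) t0 [set x | x \in O]) => // [x|l lL].
  by rewrite inE => /OP.
have [x [/andP[xO lx] xu]] := O1 l lL.
apply: (@card_eq1_in _ _ x); first by rewrite !inE xO.
by move=> y; rewrite !inE => /andP[yO ly]; apply/esym/xu; rewrite yO.
Qed.

(** * Symplectic spaces of dimension 6 *)

(** A subspace is encoded by a matrix, so over a finite field there are finitely
    many. *)
Section FiniteSubspaces.
Variables (F : finFieldType) (V : vectType F).
HB.instance Definition _ := isCountable.Build {vspace V}
  (pcan_pickleK (can_pcan (@VectorInternalTheory.vs2mxK F V))).
HB.instance Definition _ := isFinite.Build {vspace V}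
  (pcan_enumP (can_pcan (@VectorInternalTheory.vs2mxK F V))).
End FiniteSubspaces.

Section Subspaces.
Variables (F : fieldType) (V : vectType F).
Implicit Types (U W : {vspace V}) (u v : V).

Lemma dim_add_vline U v : v \notin U -> \dim (U + <[v]>) = (\dim U).+1.
Proof.
move=> vU; have v0 : v != 0%R by apply: contraNneq vU => ->; apply: mem0v.
rewrite dimv_disjoint_sum ?dim_vline ?v0 ?addn1 //; apply/eqP; rewrite -subv0.
apply/subvP => w; rewrite memv_cap memv0 => /andP[wU /vlineP[k wk]].
rewrite wk; case: (eqVneq k 0%R) => [->|k0]; first by rewrite scale0r.
by case/negP: vU; rewrite -[v](scalerK k0) -wk memvZ.
Qed.

Lemma subv_notin U W : \dim U < \dim W -> exists2 v, v \in W & v \notin U.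
Proof.
move=> dUW; have /subvPn[v] : ~~ (W <= U)%VS.
  by apply: contraTN dUW => /dimvS; rewrite -leqNgt.
by exists v.
Qed.

Lemma addv_vline_eq U W v : (U <= W)%VS -> v \in W -> v \notin U ->
  \dim W = (\dim U).+1 -> W = (U + <[v]>)%VS.
Proof.
move=> UW vW vU dW; apply/eqP; rewrite eq_sym eqEdim subv_add UW -memvE vW /=.
by rewrite dim_add_vline // dW.
Qed.

End Subspaces.

(** The subspaces of [B] covering [A] form a projective line: if [B] is spanned by
    [A], [e] and [g], they are [A + <[e]>] and the [A + <[g + c *: e]>] for scalars
    [c]. *)
Lemma card_between (F : finFieldType) (V : vectType F) (A B : {vspace V}) :
  (A <= B)%VS -> \dim B = (\dim A).+2 ->
  #|[set U : {vspace V} | [&& (A <= U)%VS, (U <= B)%VS & \dim U == (\dim A).+1]]|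
    = #|F|.+1.
Proof.
move=> AB dB; have [|e eB eA] := @subv_notin _ _ A B; first by rewrite dB.
have dAe := dim_add_vline eA.
have [|g gB gAe] := @subv_notin _ _ (A + <[e]>)%VS B; first by rewrite dAe dB.
have AeB : (A + <[e]> <= B)%VS by rewrite subv_add AB -memvE.
have gA : g \notin A by apply: contraNN gAe => /(subvP (addvSl A <[e]>)).
pose phi (c : option F) := (A + <[if c is Some c then g + c *: e else e]>)%VS%R.
have phi_e U : (A <= U)%VS -> e \in U -> \dim U = (\dim A).+1 -> U = phi None.
  by move=> AU eU dU; apply: addv_vline_eq.
have gcA c : (g + c *: e)%R \notin A.
  apply: contraNN gAe => gce; rewrite -[g](addrK (c *: e)%R).
  rewrite memvB ?(subvP (addvSl _ _) _ gce) //.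
  by rewrite memvZ // (subvP (addvSr _ _)) // memv_line.
have dphi c : \dim (phi c) = (\dim A).+1.
  by case: c => [c|]; apply: dim_add_vline.
have e_phi c : e \notin phi (Some c).
  apply/negP => eU; case/negP: gAe.
  have <- : phi (Some c) = (A + <[e]>)%VS by apply: phi_e; rewrite ?addvSl ?dphi.
  rewrite -[g](addrK (c *: e)%R) memvB ?memvZ //.
  by rewrite (subvP (addvSr _ _)) // memv_line.
have phi_inj : injective phi.
  have mem c : (g + c *: e)%R \in phi (Some c).
    by rewrite (subvP (addvSr _ _)) // memv_line.
  have eN : e \in phi None by rewrite (subvP (addvSr _ _)) // memv_line.
  move=> [c|] [d|] // E; first last.
  - by have := e_phi d; rewrite -E eN.
  - by have := e_phi c; rewrite E eN.
  congr Some; apply/eqP; apply: contraNT (e_phi c) => cd.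
  have : ((g + c *: e) - (g + d *: e))%R \in phi (Some c).
    by rewrite memvB // E mem.
  rewrite opprD addrACA subrr add0r -scalerBl => mE.
  rewrite -subr_eq0 in cd.
  by rewrite -[e](scalerK cd) memvZ.
rewrite -card_option -(card_imset _ phi_inj); congr #|pred_of_set _|.
apply/setP => U; rewrite inE; apply/and3P/imsetP => [[AU UB /eqP dU]|[c _ ->]].
  case: (boolP (e \in U)) => eU; first by exists None => //; apply: phi_e.
  have BE : B = (U + <[e]>)%VS by apply: addv_vline_eq; rewrite // dB dU.
  move: gB; rewrite BE => /memv_addP[u uU [w /vlineP[c ->] gE]].
  have uE : (u = g + (- c) *: e)%R by rewrite gE scaleNr addrK.
  by exists (Some (- c)%R) => //; apply: addv_vline_eq => //; rewrite ?gcA // -uE.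
rewrite /phi addvSl subv_add AB dphi; split=> //.
by rewrite -memvE; case: c => [c|//]; rewrite memvD // memvZ.
Qed.

Section Orthogonal.
Variables (F : fieldType) (V : vectType F) (f : {skew_symmetric V}%R).
Implicit Types (U W X : {vspace V}).

Lemma orthov_add U W : orthov f (U + W) = (orthov f U :&: orthov f W)%VS.
Proof.
apply/eqP; rewrite eqEsubv subv_cap -orthovD subvv /=.
by rewrite orthovD capvSl capvSr.
Qed.

Lemma orthovS U W : (U <= W)%VS -> (orthov f W <= orthov f U)%VS.
Proof. by move=> /addv_idPr <-; rewrite orthov_add capvSl. Qed.

Lemma dim_orthov_ge U : \dim {:V} <= \dim (orthov f U) + \dim U.
Proof.
suff /(_ (vbasis U)) : forall vs : seq V,
    \dim {:V} <= \dim (orthov f <<vs>>) + size vs.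
  by rewrite size_tuple (span_basis (vbasisP U)).
elim=> [|v vs IH] /=; first by rewrite span_nil orthov0 addn0.
rewrite span_cons orthov_add capvC.
have := leq_dim_orthov1 f v (orthov f <<vs>>); lia.
Qed.

Hypothesis nondeg : nondegenerate f.

(** Each vector imposes at most one linear condition, hence [dim_orthov_ge].  The
    orthogonals of [U] and of a complement of [U] intersect in the radical, which is
    zero, so both of these inequalities are equalities. *)
Lemma dim_orthov U : \dim (orthov f U) + \dim U = \dim {:V}.
Proof.
apply/eqP; rewrite eqn_leq dim_orthov_ge andbT.
have := dimv_sum_cap (orthov f U) (orthov f U^C).
rewrite -orthov_add addv_complf (eqP nondeg) dimv0 addn0 => E.
have := dimvS (subvf (orthov f U + orthov f U^C)%VS).
rewrite E; have := dim_orthov_ge U^C; rewrite dimv_compl.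
have := dimvS (subvf U); lia.
Qed.

Hypothesis alt : alternating f.
Notation ti := (totally_isotropic f).

Lemma ti_sub U W : (U <= W)%VS -> ti W -> ti U.
Proof.
by move=> UW tW; apply: subv_trans UW (subv_trans tW (orthovS UW)).
Qed.

Lemma ti_add U W : ti U -> ti W -> (U <= orthov f W)%VS -> ti (U + W).
Proof.
move=> tU tW UW; rewrite /totally_isotropic subv_add !orthovD UW (orthov_sym _ W).
by rewrite UW -!/(ti _) tU tW.
Qed.

Lemma ti_vline v : ti <[v]>.
Proof. by rewrite /totally_isotropic orthov11 alt. Qed.

Lemma dim_ti U : ti U -> \dim U + \dim U <= \dim {:V}.
Proof. by move=> /dimvS dU; rewrite -(dim_orthov U) leq_add2r. Qed.

End Orthogonal.

Section SymplecticPlanes.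
Variables (F : finFieldType) (V : vectType F) (f : {skew_symmetric V}%R).
Hypotheses (dimV : \dim {:V} = 6) (nondeg : nondegenerate f) (alt : alternating f).
Notation ti := (totally_isotropic f).
Implicit Types (U W X : {vspace V}).

Definition point : finType := {U : {vspace V} | \dim U == 1}.
Implicit Types (p a b : point).

Definition Point U (dU : \dim U == 1) : point :=
  exist (fun U : {vspace V} => is_true (\dim U == 1)) U dU.

(** Subspaces become sets of points, as the counting argument requires. *)
Definition points_of U : {set point} := [set p : point | (val p <= U)%VS].

Definition isotropic_flats d := points_of @: [set U | ti U && (\dim U == d)].

Lemma dim_point p : \dim (val p) = 1.
Proof. exact/eqP/(valP p). Qed.

Lemma point_vline p : exists2 v, val p = <[v]>%VS & v != 0%R.
Proof.
have v0 : vpick (val p) != 0%R by rewrite vpick0 -dimv_eq0 dim_point.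
exists (vpick (val p)) => //; apply/eqP; rewrite eq_sym eqEdim -memvE memv_pick.
by rewrite dim_vline v0 dim_point.
Qed.

Lemma vline_point v : v != 0%R -> exists p, val p = <[v]>%VS.
Proof.
move=> v0; have d1 : \dim <[v]> == 1 by rewrite dim_vline v0.
by exists (Point d1).
Qed.

Lemma points_of_sub U W :
  reflect {subset points_of U <= points_of W} (U <= W)%VS.
Proof.
apply: (iffP idP) => [UW p|sUW]; first by rewrite !inE => /subv_trans; apply.
apply/subvP => v vU; case: (eqVneq v 0%R) => [->|/vline_point[p pv]].
  exact: mem0v.
by have := sUW p; rewrite !inE pv -!memvE; apply.
Qed.

Lemma points_of_subset U W : (points_of U \subset points_of W) = (U <= W)%VS.
Proof. by apply/subsetP/points_of_sub. Qed.

Lemma points_of_inj : injective points_of.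
Proof.
by move=> U W UW; apply/eqP; rewrite eqEsubv -!points_of_subset UW subxx.
Qed.

Lemma flatP d A : reflect (exists2 U, A = points_of U & ti U /\ \dim U = d)
  (A \in isotropic_flats d).
Proof.
apply: (iffP imsetP) => [[U + ->]|[U -> [tU dU]]].
  by rewrite inE => /andP[tU /eqP dU]; exists U.
by exists U; rewrite // inE tU dU eqxx.
Qed.

Lemma mem_flat d U : (points_of U \in isotropic_flats d) = ti U && (\dim U == d).
Proof. by rewrite mem_imset ?inE //; apply: points_of_inj. Qed.

Lemma ti_point p : ti (val p).
Proof. by have [v -> _] := point_vline p; apply: ti_vline. Qed.

Lemma dim_join a b : a != b -> \dim (val a + val b) = 2.
Proof.
move=> ab; have [v bv v0] := point_vline b; rewrite bv dim_add_vline ?dim_point //.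
apply: contraNN ab => va; rewrite -val_eqE eq_sym eqEdim bv -memvE va.
by rewrite dim_vline v0 dim_point.
Qed.

Lemma join_line U a b : \dim U = 2 -> a != b -> a \in points_of U ->
  b \in points_of U -> U = (val a + val b)%VS.
Proof.
rewrite !inE => dU ab aU bU; apply/eqP.
by rewrite eq_sym eqEdim subv_add aU bU dim_join // dU.
Qed.

Lemma collinear_orthov a b :
  collinear (isotropic_flats 2) a b = (val a <= orthov f (val b))%VS.
Proof.
apply/orP/idP => [[/eqP->|/existsP[l /and3P[/flatP[U -> [tU _]]]]]|ab].
- exact: ti_point.
- by rewrite !inE => aU bU; apply: subv_trans aU (subv_trans tU (orthovS f bU)).
case: (eqVneq a b) => [->|nab]; [by left|right]; apply/existsP.
exists (points_of (val a + val b)).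
by rewrite mem_flat dim_join // ti_add ?ti_point // !inE addvSl addvSr.
Qed.

Lemma points_of_orthov U W :
  (forall p r, p \in points_of U -> r \in points_of W ->
    (val p <= orthov f (val r))%VS) -> (U <= orthov f W)%VS.
Proof.
move=> UW; apply/subvP => u uU; case: (eqVneq u 0%R) => [->|/vline_point[p pu]].
  exact: mem0v.
apply/mem_orthovP => w wW; case: (eqVneq w 0%R) => [->|/vline_point[r rw]].
  by rewrite linear0r.
have := UW p r; rewrite !inE pu rw -!memvE => /(_ uU wW).
by rewrite mem_orthov1 => /eqP.
Qed.

Lemma card_line U : \dim U = 2 -> #|points_of U| = #|F|.+1.
Proof.
move=> dU; rewrite -(@card_between _ _ 0%VS U) ?sub0v ?dimv0 //.
rewrite -(card_imset _ val_inj); congr #|pred_of_set _|; apply/setP => W.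
rewrite inE sub0v /=; apply/imsetP/andP => [[p + ->]|[WU W1]].
  by rewrite inE dim_point.
by exists (Point W1); rewrite ?inE.
Qed.

Lemma ti_dim_le3 U : ti U -> \dim U <= 3.
Proof. by move=> /(dim_ti nondeg); rewrite dimV; lia. Qed.

Lemma symplectic_planes :
  polar_planes (isotropic_flats 2) (isotropic_flats 3) #|F| #|F|.
Proof.
have F1 : 1 < #|F| by apply: card_finNzRing_gt1.
split.
- by move=> _ /flatP[U -> [_ dU]]; rewrite card_line // ltnS ltnW.
- move=> _ _ a b /flatP[U -> [_ dU]] /flatP[W -> [_ dW]] ab aU bU aW bW.
  by rewrite (join_line dU ab) // (join_line dW ab).
- move=> _ a b /flatP[X -> [tX _]] aX bX ab; exists (points_of (val a + val b)).
    rewrite mem_flat dim_join // andbT; apply: ti_sub tX.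
    by rewrite subv_add; rewrite !inE in aX bX; rewrite aX.
  rewrite !inE addvSl addvSr points_of_subset subv_add.
  by rewrite !inE in aX bX; rewrite aX.
- move=> _ _ _ /flatP[X -> [tX dX]] /flatP[U -> [_ dU]] /flatP[W -> [_ dW]].
  rewrite !points_of_subset => UX WX.
  have UWX : (U + W <= X)%VS by rewrite subv_add UX.
  have := dimvS UWX; have := dimv_sum_cap U W; rewrite dU dW dX => d1 d2.
  have v0 : vpick (U :&: W)%VS != 0%R by rewrite vpick0 -dimv_eq0; lia.
  have [p pv] := vline_point v0.
  have := memv_pick (U :&: W)%VS; rewrite memv_cap => /andP[vU vW].
  by exists p; rewrite inE pv -memvE.
- move=> _ p /flatP[X -> [tX dX]]; rewrite inE => pX.
  have [v pv v0] := point_vline p.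
  (* Otherwise [X + <[v]>] would be totally isotropic of dimension 4. *)
  have vX : v \notin orthov f X.
    apply: contraNN pX => vX; rewrite pv -memvE; apply: contraTT isT => vnX.
    have := dim_add_vline vnX; rewrite dX => d4.
    have : ti (X + <[v]>) by rewrite ti_add ?ti_vline // orthov_sym.
    by move=> /ti_dim_le3; rewrite d4.
  exists (points_of (X :&: orthov f (val p))).
    rewrite mem_flat pv -(eq_dim_orthov1 vX) dX andbT.
    by apply: ti_sub tX; apply: capvSl.
  split; first by rewrite points_of_subset capvSl.
  move=> r; rewrite !inE => rX; rewrite collinear_orthov subv_cap rX /=.
  by rewrite orthov_sym.
- move=> _ p /flatP[U -> [tU dU]]; rewrite inE => pU perp.
  have [v pv v0] := point_vline p.
  exists (points_of (U + val p)); last by rewrite points_of_subset !inE addvSl addvSr.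
  rewrite mem_flat; rewrite pv -memvE in pU.
  rewrite ti_add ?ti_point //=; first by rewrite pv dim_add_vline // dU.
  apply: points_of_orthov => r q rU; rewrite inE => qp.
  have -> : val q = val p by apply/eqP; rewrite eqEdim qp !dim_point.
  by rewrite orthov_sym -collinear_orthov perp.
- move=> _ p /flatP[X -> [tX dX]]; rewrite inE => pX.
  rewrite -(@card_between _ _ (val p) X) ?dim_point //.
  rewrite -(card_imset _ points_of_inj); congr #|pred_of_set _|; apply/setP => l.
  rewrite inE; apply/and3P/imsetP => [[/flatP[U -> [tU dU]]]|[U]].
    by rewrite inE points_of_subset => pU UX; exists U; rewrite // inE pU UX dU.
  rewrite inE => /and3P[pU UX dU] ->; rewrite mem_flat inE points_of_subset pU UX dU.
  by rewrite (ti_sub UX tX).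
- (* All 3-dimensional subspaces between [U] and its orthogonal, of dimension 4,
     are totally isotropic: each is spanned by [U] and one vector orthogonal
     to [U]. *)
  move=> _ /flatP[U -> [tU dU]]; have := dim_orthov nondeg U.
  rewrite dimV dU => dO; rewrite -(@card_between _ _ U (orthov f U)) ?dU //; last by lia.
  rewrite -(card_imset _ points_of_inj); congr #|pred_of_set _|; apply/setP => x.
  rewrite inE; apply/andP/imsetP => [[/flatP[X -> [tX dX]]]|[X]].
    rewrite points_of_subset => UX; exists X; rewrite // inE UX dX !andbT /=.
    exact: subv_trans tX (orthovS f UX).
  rewrite inE => /and3P[UX XU /eqP dX] ->; rewrite points_of_subset mem_flat UX dX.
  rewrite andbT; split=> //.
  have [|v vX vU] := @subv_notin _ _ U X; first by rewrite dU dX.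
  rewrite (addv_vline_eq UX vX vU) ?dU // ti_add ?ti_vline // orthov_sym -memvE.
  exact: (subvP XU).
have [|v _ v0] := @subv_notin _ _ (0%VS : {vspace V}) fullv; first by rewrite dimv0 dimV.
rewrite memv0 in v0; have := dim_orthov nondeg <[v]>; rewrite dimV dim_vline v0 => dO.
have [|w wv wnv] := @subv_notin _ _ <[v]>%VS (orthov f <[v]>).
  by rewrite dim_vline v0; lia.
exists (points_of (<[v]> + <[w]>)); rewrite mem_flat dim_add_vline // dim_vline v0.
by rewrite ti_add ?ti_vline // orthov_sym -memvE.
Qed.

Lemma symplectic_no_ovoid (O : {pred {vspace V}}) :
  ~ ovoid (symplectic_dual_polar_space f) O.
Proof.
move=> [OP O1]; have F1 : 1 < #|F| by apply: card_finNzRing_gt1.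
suff : (0 <= #|F|%:Z ^+ 2 - #|F|%:Z - #|F|%:Z ^+ 2 - #|F|%:Z :> int)%R.
  by move: #|F| F1 => q; lia.
apply: (ovoid_bound symplectic_planes (ltnW F1) (ltnW F1)
  (O := points_of @: [set U | U \in O])) => // [A /imsetP[U + ->]|l].
  by rewrite inE => /OP; rewrite inE mem_flat.
case/flatP=> U -> [tU dU].
have [|X [/andP[XO UX] Xu]] := O1 U; first by rewrite inE tU dU.
apply: (@card_eq1_in _ _ (points_of X)).
  by rewrite inE imset_f ?inE ?points_of_subset.
move=> A; rewrite inE => /andP[/imsetP[Y + ->]].
by rewrite inE points_of_subset => YO UY; rewrite (Xu Y) // YO.
Qed.

End SymplecticPlanes.

Theorem theorem1 :
  (forall (P : finType) (L : {set {set P}}) (s t : nat),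
     polar_space L ->
     polar_rank L 3 ->
     (forall x : P, generalized_quadrangle (quad L x) s t) ->
     2 <= s ->
     2 <= t ->
     (exists O : {pred {set P}}, ovoid (dual_polar_space L) O) ->
     (0 <= s%:Z ^+ 2 - s%:Z - t%:Z ^+ 2 - t%:Z :> int)%R)
  /\
  (forall (q : nat) (F : finFieldType) (V : vectType F)
          (f : {skew_symmetric V}%R),
     (exists p k : nat, [/\ prime p, 0 < k & q = p ^ k]) ->
     #|F| = q ->
     \dim {:V} = 6 ->
     nondegenerate f ->
     alternating f ->
     ~ exists O : {pred {vspace V}}, ovoid (symplectic_dual_polar_space f) O).
Proof.
split=> [P L s t polarL rank3 quadsL s2 t2|q F V f _ _ dimV nondeg alt [O]].
  exact: polar_space_ovoid_bound polarL rank3 quadsL s2 (ltnW t2).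
exact: symplectic_no_ovoid.
Qed.
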